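(* In each of the following posets under the consecutive order, an infinite, finitely based avoidance set $C=\mathrm{Av}(B)$ ($B$ finite) is atomic if and only if its factor graph $\Gamma_C$ is strongly connected and for each $\sigma\in C$ with $|\sigma|\in[1,b-1]$ there is $\rho\in C$ with $|\rho|=b$ such that $\sigma\leq\rho$: (1) the poset $\mathcal{G}$ of graphs; (2) the poset $\mathcal{S}$ of simple graphs; (3) the poset $\mathcal{D}$ of digraphs; (4) the poset $\mathcal{T}$ of tournaments; (5) the poset $\mathcal{R}_\sigma$ of relational structures with signature $\sigma$. Here $b$ is the maximum length of an element of $B$ ($b=1$ if $B=\varnothing$) and $\Gamma_C$ is the $b$-dimensional factor graph of $C$.
   Context: All structures are finite and carry a distinguished linear order: the underlying set is taken to be $[1,n]=\{1,\dots,n\}$ for some $n\in\mathbb{N}=\{1,2,\dots\}$ with its natural order (any finite subset of $\mathbb{N}$ may be used as underlying set, and two structures of the same kind are isomorphic, $\cong$, and then considered equal, if relabelling their points in increasing order by $1,2,\dots$ gives the same structure). The length $|\tau|$ of a structure $\tau$ is its number of points, and $\tau\upharpoonright_Y$ is its restriction to the points in $Y$; $[m,n]=\{m,m+1,\dots,n\}$. Besides the linear order: a graph has one symmetric binary relation; a simple graph has one symmetric irreflexive binary relation; a digraph has one binary relation; a tournament has one irreflexive binary relation containing exactly one of $(u,v),(v,u)$ for all distinct points $u,v$. The signature of a relational structure is the sequence of arities of its relations; a relational structure with signature $\sigma$ consists of a finite set with a sequence of relations whose arities form $\sigma$, the first relation being the distinguished linear order, with no further conditions. Consecutive order: $\tau\leq\rho$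 iff $\tau\cong\rho\upharpoonright_{[k,k+|\tau|-1]}$ for some $k\ge1$ with $k+|\tau|-1\le|\rho|$. For a subset $B$ of a poset $(X,\leq)$, $\mathrm{Av}(B)=\{x\in X: \beta\nleq x\text{ for all }\beta\in B\}$. A downward closed subset $C$ of a poset is atomic if it is not the union of two downward closed proper subsets of $C$; equivalently, for all $x,y\in C$ there is $z\in C$ with $x,y\leq z$. The $b$-dimensional factor graph $\Gamma_C$ is the digraph whose vertices are the structures in $C$ of length $b$, with an edge $u\to v$ iff $u\upharpoonright_{[2,b]}\cong v\upharpoonright_{[1,b-1]}$ (loops allowed; for $b=1$ both are restrictions to the empty set). A digraph is strongly connected if for any two vertices $u,v$ there is a directed path from $u$ to $v$.
   Formalization: In (5), signatures whose relations besides the linear order exist and are all unary are excluded: the criterion fails there, e.g. for words with B = {ba}, where Av(B) = {a^i b^j} is atomic but its factor graph is not strongly connected. *)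

(* Defs.v *)
From Stdlib Require Import Relation_Operators.
From mathcomp Require Import all_boot.
From mathcomp Require Import boolp classical_sets cardinality.

Set Implicit Arguments.
Unset Strict Implicit.
Unset Printing Implicit Defensive.

Local Open Scope classical_set_scope.

(* A structure on the points [1, n] is carried by 'I_n, the ordinal i standing
   for the point i.+1. The distinguished linear order is the natural order of
   'I_n and is not stored: [s] lists the arities of the other relations, so
   [struct s] is the type of structures with signature 2 :: s. As points are
   labelled in increasing order, isomorphism is Leibniz equality. The empty
   structure belongs to the type (it is needed as a restriction) but to none of
   the posets below. *)
Definition interp (s : seq nat) (n : nat) :=
  {dffun forall i : 'I_(size s), {set (nth 0 s i).-tuple 'I_n}}.

Definition struct (s : seq nat) := {n : nat & interp s n}.

Definition len s (x : struct s) : nat := tag x.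

Definition rels s (x : struct s) : interp s (len x) := tagged x.

(* [enum_val] lists the elements of Y in increasing order. *)
Definition restr s (x : struct s) (Y : {set 'I_(len x)}) : struct s :=
  Tagged (interp s)
    ([ffun i : 'I_(size s) =>
       [set t : (nth 0 s i).-tuple 'I_#|Y| |
         map_tuple (fun j => enum_val j) t \in rels x i]%SET] : interp s #|Y|).

Definition points n (k m : nat) : {set 'I_n} :=
  [set i : 'I_n | k <= i.+1 <= m]%SET.

Definition cons_le s (x y : struct s) : Prop :=
  exists k, [/\ 1 <= k, k + len x - 1 <= len y &
                x = restr (points (len y) k (k + len x - 1))].

Definition relstructs (s : seq nat) : set (struct s) :=
  [set x | 1 <= len x].

Arguments relstructs s : clear implicits.

Definition edge (x : struct [:: 2]) : rel 'I_(len x) :=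
  fun u v => [tuple u; v] \in rels x ord0.

Definition digraphs : set (struct [:: 2]) := relstructs [:: 2].

Definition graphs : set (struct [:: 2]) :=
  [set x | digraphs x /\ symmetric (@edge x)].

Definition simple_graphs : set (struct [:: 2]) :=
  [set x | [/\ digraphs x, symmetric (@edge x) & irreflexive (@edge x)]].

Definition tournaments : set (struct [:: 2]) :=
  [set x | [/\ digraphs x, irreflexive (@edge x) &
               forall u v, u != v -> @edge x u v (+) @edge x v u]].

(* Below, X is one of these posets, ordered by [cons_le]. *)

Definition Av s (X : set (struct s)) (B : seq (struct s)) : set (struct s) :=
  [set x | X x /\ forall y : struct s, y \in B -> ~ cons_le y x].

Definition down_closed s (X A : set (struct s)) : Prop :=
  A `<=` X /\ forall x y, X x -> A y -> cons_le x y -> A x.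

Definition atomic s (X C : set (struct s)) : Prop :=
  down_closed X C /\
  ~ exists A1 A2, [/\ down_closed X A1, down_closed X A2,
                      A1 `<` C, A2 `<` C & C = A1 `|` A2].

Definition max_len s (B : seq (struct s)) : nat :=
  if B is [::] then 1 else \max_(x <- B) len x.

Definition fg_vertex s (C : set (struct s)) (b : nat) : set (struct s) :=
  [set u | C u /\ len u = b].

Definition fg_edge s (C : set (struct s)) (b : nat) (u v : struct s) : Prop :=
  [/\ fg_vertex C b u, fg_vertex C b v &
      restr (points (len u) 2 b) = restr (points (len v) 1 (b - 1))].

Definition strongly_connected T (V : set T) (E : T -> T -> Prop) : Prop :=
  forall u v, V u -> V v -> clos_refl_trans T E u v.

Definition atomicity_criterion s (X : set (struct s)) : Prop :=
  forall B : seq (struct s), (forall y : struct s, y \in B -> X y) ->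
  let C := Av X B in
  let b := max_len B in
  infinite_set C ->
  (atomic X C <->
   strongly_connected (fg_vertex C b) (fg_edge C b) /\
   forall x, C x -> 1 <= len x <= b - 1 ->
     exists y, [/\ C y, len y = b & cons_le x y]).

(* Without a relation of arity at least 2 beyond the order, structures carrying
   unary relations are words and the criterion fails: for s = [:: 1], the words
   a^i b^j form the atomic avoidance set Av({ba}), whose factor graph
   aa -> ab -> bb is not strongly connected. *)
Definition admissible (s : seq nat) : Prop :=
  (forall a, a \in s -> 1 <= a) /\ (s = [::] \/ exists2 a, a \in s & 2 <= a).

(* Main.v *)
Require Import Defs.
From Stdlib Require Import Relation_Operators.
From mathcomp Require Import all_boot zify.
From mathcomp Require Import boolp classical_sets cardinality.

(** All five posets are handled by one argument, [criterion_at], about a class X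
    that is closed under nonempty intervals and under gluing: if the last k
    points of x form the same structure as the first k points of y, then some
    member of X consists of x followed by y with those k points shared. Atomicity
    is replaced throughout by joint embedding ([atomic_directed]).

    Suppose the factor graph is strongly connected and short members extend to
    length b. A gluing along at least b - 1 points creates no new interval of
    length at most b, so it stays in C ([Av_glue]). Hence a path from the last
    window of x to the first window of y can be followed one point at a time,
    and y glued on at the end, which embeds x and y jointly.

    Conversely, suppose C has joint embedding, and let u, v be vertices. Some
    member of C contains both. If u comes no later than v in it, then the
    windows in between form a path from u to v. Otherwise C has a member z of
    length m + b that begins with v and ends with u, and a path is found by
    induction on m ([reverse_path]). When 0 < m, the structure on all points of
    z but the last and the structure on all points but the first can be glued in
    two different ways z1, z2, since a tuple through both end points of z may be
    chosen freely. Both still lie in C, begin with v and end with u. Being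
    distinct and equally long, they occupy different places, say p < q, in a
    common extension w. If the u that ends the first copy comes no later than
    the v that begins the second, w gives the path; otherwise this v and this u
    are less than m apart, and the induction applies to the interval that they
    span.

    The two gluings exist in each of the posets ([relstructs_criterion] and
    [pairwise_criterion]), except for signatures without further relations,
    where there is a single structure of each length and hence only one
    vertex. *)

Set Implicit Arguments.
Unset Strict Implicit.
Unset Printing Implicit Defensive.

Local Open Scope classical_set_scope.

(** * Structures as predicates on lists of natural numbers *)

Section Structures.
Variable s : seq nat.
Implicit Types (x y z : struct s) (i : 'I_(size s)) (t : seq nat).

(** Lists of natural numbers stand for tuples of points, so that restriction and
    gluing act on tuples by adding or subtracting a constant, without casts
    between ordinals of different bounds. *)
Definition holds x i t : bool :=
  [exists w : (nth 0 s i).-tuple 'I_(len x),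
     (map val w == t) && (w \in rels x i)].

Definition mk n (P : 'I_(size s) -> seq nat -> bool) : struct s :=
  Tagged (interp s)
    ([ffun i : 'I_(size s) =>
       [set w : (nth 0 s i).-tuple 'I_n | P i (map val w)]%SET] : interp s n).

Definition valid n i t := (size t == nth 0 s i) && all (fun j => j < n) t.

Lemma holds_tuple x i (w : (nth 0 s i).-tuple 'I_(len x)) :
  holds x i (map val w) = (w \in rels x i).
Proof.
apply/existsP/idP => [[w' /andP[/eqP e]]|ww]; last by exists w; rewrite eqxx.
suff -> : w' = w by [].
by apply: val_inj; apply: (inj_map val_inj).
Qed.

Lemma holds_valid x i t : holds x i t -> valid (len x) i t.
Proof.
case/existsP => w /andP[/eqP<- _]; rewrite /valid size_map size_tuple eqxx /=.
by apply/allP => _ /mapP[j _ ->]; rewrite ltn_ord.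
Qed.

Lemma valid_tuple n i t : valid n i t ->
  exists w : (nth 0 s i).-tuple 'I_n, map val w = t.
Proof.
case/andP => /eqP st /allP at_.
have e : map val (pmap (insub : nat -> option 'I_n) t) = t.
  rewrite (pmap_filter (insubK _)); apply/all_filterP/allP => j jt /=.
  by rewrite insubT ?at_.
have sz : size (pmap (insub : nat -> option 'I_n) t) == nth 0 s i.
  by rewrite -(size_map val) e st.
by exists (Tuple sz).
Qed.

Lemma holds_mk n P i t : holds (mk n P) i t = valid n i t && P i t.
Proof.
case vt : (valid n i t) => /=; last by apply/negbTE/negP => /holds_valid; rewrite vt.
have [w <-] := valid_tuple vt.
by rewrite (@holds_tuple (mk n P)) /rels /= ffunE inE.
Qed.

Lemma struct_eq x y :
  len x = len y -> (forall i t, holds x i t = holds y i t) -> x = y.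
Proof.
case: x => n f; case: y => n' g; rewrite /len /= => e; subst n' => h.
congr existT; apply/ffunP => i; apply/setP => w.
by have := h i (map val w); rewrite !holds_tuple.
Qed.

Definition win x k m : struct s := mk m (fun i t => holds x i (map (addn k) t)).

Lemma len_win x k m : len (win x k m) = m. Proof. by []. Qed.

Lemma valid_shift k m n i t :
  k + m <= n -> valid m i t -> valid n i (map (addn k) t).
Proof.
move=> kmn /andP[st /allP at_]; rewrite /valid size_map st /=.
by apply/allP => _ /mapP[j /at_ jm ->]; lia.
Qed.

Lemma holds_win x k m i t :
  holds (win x k m) i t = valid m i t && holds x i (map (addn k) t).
Proof. exact: holds_mk. Qed.

Lemma winw x k m k' m' : k' + m' <= m ->
  win (win x k m) k' m' = win x (k + k') m'.
Proof.
move=> h; apply: struct_eq => // i t; rewrite !holds_win.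
case vt : (valid m' i t) => //=; rewrite (valid_shift h vt) -map_comp /=.
by congr holds; apply: eq_map => j /=; rewrite addnA.
Qed.

Lemma win_full x : win x 0 (len x) = x.
Proof.
apply: struct_eq => // i t; rewrite holds_win map_id_in //.
by apply/andP/idP => [[]|h] //; split=> //; apply: holds_valid.
Qed.

(** The increasing enumeration used by [restr] is, on an interval, the shift by
    its first point; this turns [restr] into [win]. *)
Lemma enum_points n k m : k + m <= n ->
  map val (enum (points n k.+1 (k + m))) = iota k m.
Proof.
move=> kmn; transitivity [seq j <- iota 0 n | k < j.+1 <= k + m].
  rewrite -val_enum_ord filter_map {1}/enum_mem -enumT; congr map.
  by apply: eq_filter => i /=; rewrite inE.
apply: (irr_sorted_eq ltn_trans ltnn).
- by apply: sorted_filter; [exact: ltn_trans | exact: iota_ltn_sorted].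
- exact: iota_ltn_sorted.
by move=> j; rewrite mem_filter !mem_iota; lia.
Qed.

Lemma restr_points x k m : k + m <= len x ->
  restr (points (len x) k.+1 (k + m)) = win x k m.
Proof.
move=> kmn; set Y := points _ _ _.
have cY : #|Y| = m by rewrite cardE -(size_map val) enum_points ?size_iota.
rewrite /win -[in RHS]cY; congr existT; apply/ffunP => i; rewrite !ffunE.
apply/setP => w; rewrite !inE -holds_tuple /= -!map_comp; congr holds.
apply: eq_map => j /=.
have jm : j < m by rewrite -cY.
rewrite (enum_val_nth (enum_val j)) -(nth_map _ 0 val) -?cardE ?cY //.
by rewrite enum_points // nth_iota.
Qed.

(** Points are counted from 1 in [cons_le] and from 0 here. *)
Lemma cons_leP x y : cons_le x y <->
  exists2 k, k + len x <= len y & x = win y k (len x).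
Proof.
split=> [[[|k] [] // _ h e]|[k h e]].
  have h' : k + len x <= len y by lia.
  exists k => //; rewrite [LHS]e -restr_points //; congr restr; congr points; lia.
exists k.+1; split=> //; first lia.
rewrite [LHS]e -restr_points //; congr restr; congr points; lia.
Qed.

Lemma cons_le_win y k m : k + m <= len y -> cons_le (win y k m) y.
Proof. by move=> h; apply/cons_leP; exists k. Qed.

Lemma cons_le_refl x : cons_le x x.
Proof. by apply/cons_leP; exists 0 => //; rewrite win_full. Qed.

Lemma cons_le_trans y x z : cons_le x y -> cons_le y z -> cons_le x z.
Proof.
move=> /cons_leP[k h e] /cons_leP[k' h' e']; apply/cons_leP; exists (k' + k).
  lia.
by rewrite [LHS]e e' winw.
Qed.

(** The length is bounded by the finite type of ordinals, over which the
    structures form a finite dependent sum. *)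
Lemma finite_len n : finite_set [set x : struct s | len x < n].
Proof.
pose T := {k : 'I_n & interp s k}.
pose f (a : T) : struct s := Tagged (interp s) (tagged a).
have fT : finite_set [set: {k : 'I_n & {dffun forall i : 'I_(size s),
  {set (nth 0 s i).-tuple 'I_k}}}] by exact: finite_finset.
apply: (@sub_finite_set _ _ (f @` [set: T])); last exact: finite_image.
case=> k g /= kn; exists (existT (fun k : 'I_n => interp s k) (Ordinal kn) g) => //.
Qed.

Definition is_glue x y k z :=
  [/\ len z = len x + len y - k, win z 0 (len x) = x &
      win z (len x - k) (len y) = y].

(** The default [d] decides the tuples that have a point outside x and a point
    outside y: no condition on the two intervals concerns them. *)
Definition glue (d : seq nat -> bool) x y k : struct s :=
  mk (len x + len y - k) (fun i t =>
    if all (fun j => j < len x) t then holds x i t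
    else if all (fun j => len x - k <= j) t
         then holds y i (map (subn^~ (len x - k)) t)
    else d t).

(** On tuples of shared points the definition of [glue] consults x only; they
    are right for y as well because the overlaps agree. *)
Lemma glueP d x y k : k <= len x -> k <= len y ->
  win x (len x - k) k = win y 0 k -> is_glue x y k (glue d x y k).
Proof.
move=> kx ky e; split=> //; apply: struct_eq => // i t; rewrite holds_win.
  case vt : (valid (len x) i t) => /=; last first.
    by apply/esym/negbTE/negP => /holds_valid; rewrite vt.
  rewrite holds_mk (valid_shift _ vt); last lia.
  by rewrite map_id_in //; case/andP: vt => _ ->.
case vt : (valid (len y) i t) => /=; last first.
  by apply/esym/negbTE/negP => /holds_valid; rewrite vt.
rewrite holds_mk (valid_shift _ vt); last lia.
have /andP[st _] := vt.
case: ifP => /= [ax|_].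
  have vk : valid k i t.
    rewrite /valid st; apply/allP => j jt.
    have /= := allP ax _ (map_f (addn (len x - k)) jt); lia.
  have := congr1 (fun z => holds z i t) e.
  by rewrite !holds_win vk /= => ->; rewrite map_id_in.
rewrite all_map (_ : all _ _); last by apply/allP => j _ /=; lia.
by rewrite -map_comp map_id_in // => j _ /=; lia.
Qed.

End Structures.

(** * The criterion for classes with free gluing *)

Section Criterion.
Variables (s : seq nat) (X : set (struct s)).
Implicit Types (x y z u v w : struct s).

Hypothesis X_nonempty : forall x, X x -> 0 < len x.
Hypothesis X_win : forall x k m, X x -> 0 < m -> k + m <= len x -> X (win x k m).
Hypothesis X_glue : forall x y k, X x -> X y -> k <= len x -> k <= len y ->
  win x (len x - k) k = win y 0 k -> exists2 z, X z & is_glue x y k z.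
(** If one of the structures lies inside the other the gluing is unique, hence
    the strict bounds on k. The second alternative covers linear orders without
    further relations. *)
Hypothesis X_branch :
  (forall x y k, X x -> X y -> k < len x -> k < len y ->
     win x (len x - k) k = win y 0 k ->
     exists z1 z2, [/\ X z1, X z2, is_glue x y k z1, is_glue x y k z2 & z1 <> z2])
  \/ (forall x y, len x = len y -> x = y).

Definition directed (C : set (struct s)) : Prop :=
  forall x y, C x -> C y -> exists z, [/\ C z, cons_le x z & cons_le y z].

(** If x and y have no common upper bound in C, then the members of C not above
    x and those not above y are two proper downward closed sets covering C. *)
Lemma atomic_directed C : down_closed X C -> (atomic X C <-> directed C).
Proof.
move=> dC; split=> [[_ irr] x y Cx Cy|dirC].
  apply: contrapT => noub; apply: irr.
  have below a : C a -> down_closed X [set z | C z /\ ~ cons_le a z].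
    move=> Ca; split=> [z [Cz _]|z z' Xz [Cz' az'] zz']; first exact: dC.1.
    by split; [exact: dC.2 zz' | move=> az; apply: az'; exact: cons_le_trans zz'].
  have prop a : C a -> [set z | C z /\ ~ cons_le a z] `<` C.
    move=> Ca; split=> [z []//|/(_ _ Ca) [_]]; apply; exact: cons_le_refl.
  exists [set z | C z /\ ~ cons_le x z], [set z | C z /\ ~ cons_le y z].
  split; [exact: below | exact: below | exact: prop | exact: prop |].
  apply/seteqP; split=> [z Cz|z [[]|[]]//].
  case: (pselect (cons_le x z)) => [xz|]; last by left.
  by right; split=> // yz; apply: noub; exists z.
split=> // -[A1 [A2 [d1 d2 [_ p1] [_ p2] CE]]].
have [x [Cx A1x]] : exists x, C x /\ ~ A1 x.
  by apply: contrapT => h; apply: p1 => x Cx; apply: contrapT => ?; apply: h; exists x.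
have [y [Cy A2y]] : exists x, C x /\ ~ A2 x.
  by apply: contrapT => h; apply: p2 => z Cz; apply: contrapT => ?; apply: h; exists z.
have [z [Cz xz yz]] := dirC _ _ Cx Cy.
move: Cz; rewrite CE => -[Az|Az].
  by apply: A1x; apply: d1.2 xz; first exact: dC.1.
by apply: A2y; apply: d2.2 yz; first exact: dC.1.
Qed.

Variable B : seq (struct s).
Hypothesis BX : forall y, y \in B -> X y.
Let C := Av X B.
Let b := max_len B.

Lemma max_len_ge y : y \in B -> len y <= b.
Proof.
rewrite /b /max_len; case: B => // a r yB.
by apply: (@leq_bigmax_seq _ _ xpredT (@len s)).
Qed.

Lemma max_len_gt0 : 0 < b.
Proof.
case E : B => [|a r]; first by rewrite /b E.
have aB : a \in B by rewrite E mem_head.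
exact: leq_trans (X_nonempty (BX aB)) (max_len_ge aB).
Qed.

Lemma Av_down : down_closed X C.
Proof.
split=> [x []//|x y Xx [_ hy] xy]; split=> // z zB zx.
by apply: (hy z) => //; exact: cons_le_trans zx xy.
Qed.

Lemma Av_win x k m : C x -> 0 < m -> k + m <= len x -> C (win x k m).
Proof.
move=> Cx m0 h; apply: Av_down.2 (Cx) _; last exact: cons_le_win.
by apply: X_win => //; case: Cx.
Qed.

(** A forbidden structure has at most b points, so an occurrence that is not
    inside x starts so late that it is inside y. *)
Lemma Av_glue x y k z : C x -> C y -> k <= len x -> k <= len y -> b <= k.+1 ->
  is_glue x y k z -> X z -> C z.
Proof.
move=> [_ Cx] [_ Cy] kx ky bk [lz zx zy] Xz; split=> // a aB /cons_leP[p h e].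
have lab := max_len_ge aB.
case: (leqP (p + len a) (len x)) => hp.
  apply: (Cx _ aB); rewrite -zx e -[p]add0n -(winw _ _ (m := len x)) //.
  exact: cons_le_win.
apply: (Cy _ aB); rewrite -zy e (_ : p = (len x - k) + (p - (len x - k))).
  by rewrite -(winw _ _ (m := len y)); [apply: cons_le_win; rewrite len_win |]; lia.
lia.
Qed.

Lemma Av_glueE x y k : C x -> C y -> k <= len x -> k <= len y -> b <= k.+1 ->
  win x (len x - k) k = win y 0 k -> exists2 z, C z & is_glue x y k z.
Proof.
move=> Cx Cy kx ky bk e.
have [z Xz gz] := X_glue (Av_down.1 _ Cx) (Av_down.1 _ Cy) kx ky e.
by exists z => //; exact: Av_glue gz Xz.
Qed.

Lemma fg_edge_win u v : fg_edge C b u v <->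
  [/\ fg_vertex C b u, fg_vertex C b v & win u 1 (b - 1) = win v 0 (b - 1)].
Proof.
have b0 := max_len_gt0.
have h (x : struct s) : len x = b ->
  restr (points (len x) 2 b) = win x 1 (b - 1) /\
  restr (points (len x) 1 (b - 1)) = win x 0 (b - 1).
  by move=> lx; split; rewrite -restr_points; last 1 [lia] || idtac;
     try congr restr; try congr points; lia.
by rewrite /fg_edge; split=> -[[Cu lu] [Cv lv]]; rewrite (h u lu).1 (h v lv).2.
Qed.

(** Consecutive windows of length b overlap in b - 1 points. *)
Lemma window_path w p q : C w -> p <= q -> q + b <= len w ->
  clos_refl_trans _ (fg_edge C b) (win w p b) (win w q b).
Proof.
move=> Cw pq; have b0 := max_len_gt0.
have -> : q = p + (q - p) by lia.
elim: (q - p) => [|d IH] h; first by rewrite addn0; exact: rt_refl.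
apply: rt_trans (IH _) _; first lia.
apply: rt_step; apply/fg_edge_win; split; try (split=> //; apply: Av_win; lia || by []).
by rewrite !winw; [congr win|..]; lia.
Qed.

(** Each edge of the path adds one point: the next vertex is glued onto the
    structure built so far along b - 1 points. *)
Lemma path_extend u v : clos_refl_trans _ (fg_edge C b) u v ->
  forall x, C x -> b <= len x -> win x (len x - b) b = u ->
  exists z, [/\ C z, b <= len z, cons_le x z & win z (len z - b) b = v].
Proof.
have b0 := max_len_gt0.
elim=> {u v} [u v /fg_edge_win[_ [Cv lv] e]|u|u v w _ IH1 _ IH2] x Cx bx xu.
- have [||||z Cz [lz zx zv]] := @Av_glueE x v (b - 1) Cx Cv; try lia.
    rewrite -e -xu winw; last lia.
    by congr win; lia.
  exists z; split=> //; first lia.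
    by rewrite -zx; apply: cons_le_win; lia.
  by rewrite -[RHS]zv lv; congr win; lia.
- by exists x; split=> //; exact: cons_le_refl.
have [z [Cz bz xz zv]] := IH1 x Cx bx xu.
have [t [Ct bt zt tw]] := IH2 z Cz bz zv.
by exists t; split=> //; exact: cons_le_trans zt.
Qed.

Lemma directed_of_strongly_connected :
  strongly_connected (fg_vertex C b) (fg_edge C b) ->
  (forall x, C x -> 1 <= len x <= b - 1 ->
     exists y, [/\ C y, len y = b & cons_le x y]) -> directed C.
Proof.
move=> sc ext; have b0 := max_len_gt0.
have {}ext x : C x -> exists y, [/\ C y, b <= len y & cons_le x y].
  move=> Cx; case: (leqP b (len x)) => h.
    by exists x; split=> //; exact: cons_le_refl.
  have [|y [Cy ly xy]] := ext x Cx; last by exists y; split=> //; rewrite ly.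
  by have := X_nonempty (Av_down.1 _ Cx); lia.
move=> x0 y0 /ext[x [Cx bx xx]] /ext[y [Cy by_ yy]].
have [||z [Cz bz xz zy]] :=
  path_extend (sc (win x (len x - b) b) (win y 0 b) _ _) Cx bx erefl.
- by split=> //; apply: Av_win => //; lia.
- by split=> //; apply: Av_win => //; lia.
have [|t Ct [lt tz ty]] := Av_glueE Cz Cy bz by_ _ zy; first lia.
exists t; split=> //.
  apply: cons_le_trans xx (cons_le_trans xz _).
  by rewrite -tz; apply: cons_le_win; lia.
apply: cons_le_trans yy _.
by rewrite -ty; apply: cons_le_win; lia.
Qed.

(** The main step: a structure running from v to u yields a path from u back to
    v. The two gluings of its end-trimmed intervals sit at different places of a
    common extension, which either shows a path or contains a shorter structure
    running from v to u. *)
Lemma reverse_path m u v z : directed C -> C z -> len z = m + b ->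
  win z 0 b = v -> win z m b = u -> clos_refl_trans _ (fg_edge C b) u v.
Proof.
move=> dirC; have b0 := max_len_gt0.
elim/ltn_ind: m z => m IH z Cz lz zv zu.
case: X_branch => [branch|rigid]; last first.
  have -> : u = v by apply: rigid; rewrite -zu -zv.
  exact: rt_refl.
case: m IH lz zu => [|m] IH lz zu; first by rewrite -zu -zv; exact: rt_refl.
pose n := m + b.
(* The trimmed intervals have n = m + b points and share n - 1 >= b - 1 of
   them, so regluing keeps all windows of length b. *)
have Cx : C (win z 0 n) by apply: Av_win => //; lia.
have Cy : C (win z 1 n) by apply: Av_win => //; lia.
have [|||z1 [z2 [X1 X2 g1 g2 ne]]] :=
  branch _ _ n.-1 (Av_down.1 _ Cx) (Av_down.1 _ Cy).
- by rewrite len_win; lia.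
- by rewrite len_win; lia.
- by rewrite len_win !winw; [congr win|..]; lia.
have good z' : X z' -> is_glue (win z 0 n) (win z 1 n) n.-1 z' ->
    [/\ C z', len z' = m.+1 + b, win z' 0 b = v & win z' m.+1 b = u].
  move=> X' g; split.
  - by apply: Av_glue g X' => //; rewrite ?len_win; lia.
  - by case: g => ->; rewrite !len_win; lia.
  - case: g => _ + _; rewrite len_win => /(congr1 (fun w => win w 0 b)).
    by rewrite !winw ?addn0 ?zv //; lia.
  case: g => _ _; rewrite !len_win => /(congr1 (fun w => win w m b)).
  rewrite !winw; try lia.
  by rewrite add1n zu => <-; congr win; lia.
have [C1 l1 v1 u1] := good _ X1 g1.
have [C2 l2 v2 u2] := good _ X2 g2.
have [w [Cw /cons_leP[p hp ep] /cons_leP[q hq eq]]] := dirC _ _ C1 C2.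
rewrite l1 in hp ep; rewrite l2 in hq eq.
wlog pq : p q z1 z2 X1 X2 g1 g2 ne C1 l1 v1 u1 C2 l2 v2 u2 hp ep hq eq / p < q.
  move=> H; case: (ltngtP p q) => pq; first exact: (H p q z1 z2).
    by apply: (H q p z2 z1) => // e; apply: ne.
  by case: ne; rewrite ep eq pq.
have wu : win w (p + m.+1) b = u by rewrite -u1 ep winw.
have wv : win w q b = v by rewrite -v2 eq winw ?addn0 //; lia.
(* In w, u occurs at p + m.+1 and v at q. *)
case: (leqP (p + m.+1) q) => h.
  by rewrite -wu -wv; apply: window_path => //; lia.
apply: (IH (p + m.+1 - q) _ (win w q (p + m.+1 - q + b))).
- lia.
- by apply: Av_win => //; lia.
- by rewrite len_win.
- by rewrite winw ?addn0 //; lia.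
by rewrite winw -?wu //; congr win; lia.
Qed.

Lemma strongly_connected_of_directed :
  directed C -> strongly_connected (fg_vertex C b) (fg_edge C b).
Proof.
move=> dirC u v [Cu lu] [Cv lv]; have b0 := max_len_gt0.
have [w [Cw /cons_leP[p hp ep] /cons_leP[q hq eq]]] := dirC _ _ Cu Cv.
rewrite lu in hp ep; rewrite lv in hq eq.
case: (leqP p q) => h; first by rewrite ep eq; exact: window_path.
apply: (@reverse_path (p - q) _ _ (win w q (p - q + b))) => //.
- by apply: Av_win => //; lia.
- by rewrite winw ?addn0 -?eq //; lia.
by rewrite winw // [RHS]ep; congr win; lia.
Qed.

(** Since C is infinite it has a long member; a common extension of it and x
    leaves room for a window of length b around x. *)
Lemma extension_of_directed x : infinite_set C -> directed C ->
  C x -> len x < b -> exists y, [/\ C y, len y = b & cons_le x y].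
Proof.
move=> infC dirC Cx xb; have b0 := max_len_gt0.
have [y Cy yb] : exists2 y, C y & b <= len y.
  apply: contrapT => h; apply: infC; apply: sub_finite_set (finite_len s b).
  by move=> y Cy /=; rewrite ltnNge; apply/negP => yb; apply: h; exists y.
have [z [Cz /cons_leP[p hp ep] /cons_leP[q hq eq]]] := dirC _ _ Cx Cy.
(* A window starting at p could overrun z; it is then moved to the end. *)
pose r := minn p (len z - b).
exists (win z r b); split=> //; first by apply: Av_win => //; lia.
rewrite [x in cons_le x]ep (_ : p = r + (p - r)); last lia.
by rewrite -(winw _ _ (m := b)); [apply: cons_le_win; rewrite len_win|]; lia.
Qed.

Lemma criterion_at : infinite_set C ->
  (atomic X C <->
   strongly_connected (fg_vertex C b) (fg_edge C b) /\
   forall x, C x -> 1 <= len x <= b - 1 ->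
     exists y, [/\ C y, len y = b & cons_le x y]).
Proof.
move=> infC; rewrite (atomic_directed Av_down); split=> [dirC|[]].
  split=> [|x Cx lx]; first exact: strongly_connected_of_directed.
  by apply: extension_of_directed => //; lia.
exact: directed_of_strongly_connected.
Qed.

End Criterion.

(** * The five posets *)

Lemma glue_neq s (d1 d2 : seq nat -> bool) (x y : struct s) k (i : 'I_(size s)) t :
  valid (len x + len y - k) i t ->
  ~~ all (fun j => j < len x) t -> ~~ all (fun j => len x - k <= j) t ->
  d1 t <> d2 t -> glue d1 x y k <> glue d2 x y k.
Proof.
move=> vt /negbTE h1 /negbTE h2 ne /(congr1 (fun z => holds z i t)).
by rewrite !holds_mk vt h1 h2.
Qed.

(** A relation of arity a >= 2 has a tuple through the first and the last point
    of a gluing, so the empty and the full default give different results. *)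
Lemma relstructs_criterion s : admissible s -> atomicity_criterion (relstructs s).
Proof.
move=> [_ adm] B BX /=; apply: criterion_at => //.
- move=> x y k Xx Xy kx ky e; exists (glue xpred0 x y k); last exact: glueP.
  by have x0 : 0 < len x := Xx; change (0 < len x + len y - k); lia.
case: adm => [s0|[a a_s a2]]; [right|left].
  (* No relation besides the order: structures are determined by length. *)
  move=> x y e; apply: struct_eq => // i; move: (ltn_ord i).
  by rewrite {2}s0.
move=> x y k Xx Xy kx ky e.
have X' z : is_glue x y k z -> relstructs s z.
  by case=> lz _ _; rewrite /relstructs /= lz; lia.
have g d := glueP d (ltnW kx) (ltnW ky) e.
exists (glue xpred0 x y k), (glue xpredT x y k).
split; [exact: X' | exact: X' | by [] | by [] |].
have ia : index a s < size s by rewrite index_mem.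
pose N := len x + len y - k.
apply: (@glue_neq _ _ _ _ _ _ (Ordinal ia) (0 :: nseq a.-1 N.-1)) => //.
- rewrite /valid /= size_nseq nth_index // prednK ?eqxx /=; last lia.
  by rewrite all_nseq; lia.
- by rewrite /= all_nseq; lia.
by rewrite /=; lia.
Qed.

Section Binary.
Variables (D : pred bool) (P : rel bool).

Definition rel2 (x : struct [:: 2]) (u v : nat) : bool := holds x ord0 [:: u; v].

(** Graphs, simple graphs and tournaments restrict loops by some D, and the pair
    of truth values of (u, v) and (v, u), for u < v, by some P. Such conditions
    involve one pair of points at a time, so they survive gluing. *)
Definition pairwise_class : set (struct [:: 2]) :=
  [set x | [/\ 0 < len x, forall u, u < len x -> D (rel2 x u u) &
     forall u v, u < v -> v < len x -> P (rel2 x u v) (rel2 x v u)]].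

(** The default that gives all undecided pairs u < v the same pattern p,
    read backwards on [:: v; u]. *)
Definition fill (p : bool * bool) (t : seq nat) : bool :=
  if nth 0 t 0 < nth 0 t 1 then p.1 else p.2.

Lemma pairwise_win x k m : pairwise_class x -> 0 < m -> k + m <= len x ->
  pairwise_class (win x k m).
Proof.
move=> [_ dx px] m0 h; split=> // [u|u v uv]; rewrite len_win => um;
  rewrite /rel2 !holds_win /valid /=.
  by rewrite um /=; apply: dx; lia.
by rewrite um (ltn_trans uv um) /=; apply: px; lia.
Qed.

Lemma pairwise_glue p x y k : P p.1 p.2 ->
  pairwise_class x -> pairwise_class y -> k <= len x -> k <= len y ->
  pairwise_class (glue (fill p) x y k).
Proof.
move=> Pp [x0 dx px] [y0 dy py] kx ky.
have lz : len (glue (fill p) x y k) = len x + len y - k by [].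
split=> [|u|u v uv]; rewrite lz; first lia.
  move=> uz; rewrite /rel2 !holds_mk /valid /= uz /= !andbT !andbb.
  case: ltnP => ux; first exact: dx.
  by rewrite (_ : _ <= u); [apply: dy|]; lia.
move=> vz; rewrite /rel2 !holds_mk /valid /= vz (ltn_trans uv vz) /= !andbT.
rewrite /fill /= uv (ltnNge v u) (ltnW uv) /=.
case: (ltnP v (len x)) => vx.
  by rewrite (ltn_trans uv vx) /=; apply: px.
rewrite andbF (_ : _ <= v); last lia.
by rewrite andbT /=; case: leqP => // ux; apply: py; lia.
Qed.

(** Two allowed patterns p, q for a pair of points give two different gluings:
    they disagree on the pair of extreme points, in one of its orientations. *)
Lemma pairwise_criterion p q : p != q -> P p.1 p.2 -> P q.1 q.2 ->
  atomicity_criterion pairwise_class.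
Proof.
move=> pq Pp Pq B BX /=; apply: criterion_at => //.
- by move=> x [].
- exact: pairwise_win.
- move=> x y k Xx Xy kx ky e.
  by exists (glue (fill p) x y k); [exact: pairwise_glue | exact: glueP].
left=> x y k Xx Xy kx ky e.
have g d := glueP d (ltnW kx) (ltnW ky) e.
exists (glue (fill p) x y k), (glue (fill q) x y k).
split=> //; try (apply: pairwise_glue => //; exact: ltnW).
pose N := len x + len y - k.
have [ne|/negbNE/eqP e1] := boolP (p.1 != q.1).
  apply: (@glue_neq [:: 2] _ _ _ _ _ ord0 [:: 0; N.-1]); rewrite /valid /fill /=; try lia.
  by rewrite (_ : 0 < N.-1); [exact/eqP | lia].
apply: (@glue_neq [:: 2] _ _ _ _ _ ord0 [:: N.-1; 0]); rewrite /valid /fill /=; try lia.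
move=> e2; move/eqP: pq; apply; move: e1 e2.
by case: (p) (q) => a c [a' c'] /= -> ->.
Qed.

End Binary.

Lemma edge_rel2 (x : struct [:: 2]) u v : @edge x u v = rel2 x u v.
Proof. exact/esym/(@holds_tuple _ x ord0 [tuple u; v]). Qed.

Lemma graphsE : graphs = pairwise_class xpredT eqb.
Proof.
apply/seteqP; split=> x.
  move=> [x0 sx]; split=> // u v uv vx; apply: (introT eqP).
  have := sx (Ordinal (ltn_trans uv vx)) (Ordinal vx).
  by rewrite !edge_rel2.
move=> [x0 _ px]; split=> // u v; rewrite !edge_rel2.
by case: (ltngtP u v) => [uv|uv|->] //; [|apply: esym];
  exact: (elimT eqP (px _ _ uv (ltn_ord _))).
Qed.

Lemma simple_graphsE : simple_graphs = pairwise_class negb eqb.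
Proof.
apply/seteqP; split=> x.
  move=> [x0 sx ix]; split=> // [u ux|u v uv vx].
    by have := ix (Ordinal ux); rewrite edge_rel2 /= => ->.
  apply: (introT eqP); have := sx (Ordinal (ltn_trans uv vx)) (Ordinal vx).
  by rewrite !edge_rel2.
move=> [x0 dx px]; split=> // [u v|u]; rewrite !edge_rel2; last exact/negbTE/dx.
by case: (ltngtP u v) => [uv|uv|->] //; [|apply: esym];
  exact: (elimT eqP (px _ _ uv (ltn_ord _))).
Qed.

Lemma tournamentsE : tournaments = pairwise_class negb addb.
Proof.
apply/seteqP; split=> x.
  move=> [x0 ix tx]; split=> // [u ux|u v uv vx].
    by have := ix (Ordinal ux); rewrite edge_rel2 /= => ->.
  have := tx (Ordinal (ltn_trans uv vx)) (Ordinal vx).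
  by rewrite !edge_rel2 -val_eqE /=; apply; lia.
move=> [x0 dx px]; split=> // [u|u v]; rewrite !edge_rel2; first exact/negbTE/dx.
rewrite -val_eqE /=; case: (ltngtP u v) => // uv _; first exact: px.
by rewrite addbC; apply: px.
Qed.

Theorem corollary8p4 :
  [/\ atomicity_criterion graphs,
      atomicity_criterion simple_graphs,
      atomicity_criterion digraphs,
      atomicity_criterion tournaments &
      forall s : seq nat, admissible s -> atomicity_criterion (relstructs s)].
Proof.
split; last exact: relstructs_criterion.
- rewrite graphsE; exact: (@pairwise_criterion _ _ (true, true) (false, false)).
- rewrite simple_graphsE.
  exact: (@pairwise_criterion _ _ (true, true) (false, false)).
- apply: relstructs_criterion; split=> [a|]; first by rewrite inE => /eqP ->.
  by right; exists 2.
rewrite tournamentsE.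
exact: (@pairwise_criterion _ _ (true, false) (false, true)).
Qed.
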